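(* Let $F$ be a field of characteristic zero, let $n\ge 1$, and consider $M_n(F)$ with the Di Vincenzo--Vasilovsky $\mathbb{Z}_n$-grading. Let $A$ be a graded subalgebra of $M_n(F)$ generated by elementary matrices. Then the graded polynomial identities of $A$ follow from $I_n$ and from the monomial identities of $A$; that is, $T_{\mathbb{Z}_n}(A)$ is the $T_{\mathbb{Z}_n}$-ideal of $F\langle X|\mathbb{Z}_n\rangle$ generated by $I_n$ together with all monomials that are graded polynomial identities of $A$.
   Context: All algebras are associative and unitary. Elementary matrices $e_{ij}$ ($1\le i,j\le n$) have $(i,j)$-entry $1$ and all other entries $0$. The Di Vincenzo--Vasilovsky grading is $M_n(F)=\bigoplus_{t\in\mathbb{Z}_n}M_n^{(t)}$, where $M_n^{(t)}$ is the span of the $e_{ij}$ with $j-i\equiv t\pmod n$. $F\langle X|\mathbb{Z}_n\rangle$ is the free associative $\mathbb{Z}_n$-graded algebra on $X=\bigcup_{g\in\mathbb{Z}_n}X^g$, where the $X^g$ are disjoint countable sets of variables; variables in $X^g$ have degree $g$, and the degree of a monomial is the sum of the degrees of its variables. A $T_{\mathbb{Z}_n}$-ideal is an ideal invariant under all degree-preserving algebra endomorphisms of $F\langle X|\mathbb{Z}_n\rangle$. A polynomial $f(x_1,\dots,x_t)\in F\langle X|\mathbb{Z}_n\rangle$ is a graded polynomial identity of a $\mathbb{Z}_n$-graded algebra $A$ if $f(a_1,\dots,a_t)=0$ whenever $a_k\in A^{\deg(x_k)}$ for all $k$; $T_{\mathbb{Z}_n}(A)$ is the $T_{\mathbb{Z}_n}$-ideal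 of all of them. A monomial identity of $A$ is a monomial that is a graded polynomial identity of $A$. A polynomial follows from (is a consequence of) a set if it lies in the $T_{\mathbb{Z}_n}$-ideal generated by that set. $I_n$ is the $T_{\mathbb{Z}_n}$-ideal generated by the polynomials $[x_1,x_2]=x_1x_2-x_2x_1$ with $\deg(x_1)=\deg(x_2)=0$ and $x_1x_2x_3-x_3x_2x_1$ with $\deg(x_1)=-\deg(x_2)=\deg(x_3)$. *)

(* Defs.v *)
From mathcomp Require Export all_boot all_order all_algebra.
From mathcomp Require Export falgebra.
From mathcomp Require Export monalg.

Set Implicit Arguments.
Unset Strict Implicit.
Unset Printing Implicit Defensive.

Import GRing.Theory.
Local Open Scope ring_scope.

(* Matrices have size n.+1, so that every size >= 1 is covered, and the
   grading group is the cyclic group 'I_n.+1 with addition modulo n.+1.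
   A variable is a pair (t, k): the k-th variable of degree t. *)
Notation gvar n := ('I_n.+1 * nat)%type.
Notation free_galg F n := {malg F[{fmonom gvar n}]}.

Definition mon_deg n (w : {fmonom gvar n}) : 'I_n.+1 :=
  \sum_(x <- (w : seq (gvar n))) x.1.

Definition gX (F : fieldType) n (t : 'I_n.+1) (k : nat) : free_galg F n :=
  << fmu (t, k) >>.

Definition homogeneous (F : fieldType) n (t : 'I_n.+1) (f : free_galg F n) :
    Prop :=
  forall w, f@_w != 0 -> mon_deg w = t.

(* Morphisms of unitary algebras, hence endomorphisms may send a variable of
   degree 0 to a polynomial with a nonzero constant term. *)
Definition graded_endo (F : fieldType) n
    (phi : {lrmorphism free_galg F n -> free_galg F n}) : Prop :=
  forall t f, homogeneous t f -> homogeneous t (phi f).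

Definition is_ideal (F : fieldType) n (P : free_galg F n -> Prop) : Prop :=
  [/\ P 0,
      forall f g, P f -> P g -> P (f + g),
      forall h f, P f -> P (h * f)
    & forall h f, P f -> P (f * h)].

Definition T_ideal (F : fieldType) n (P : free_galg F n -> Prop) : Prop :=
  is_ideal P /\
  forall phi : {lrmorphism free_galg F n -> free_galg F n},
    graded_endo phi -> forall f, P f -> P (phi f).

Definition T_ideal_gen (F : fieldType) n (S : free_galg F n -> Prop)
    (f : free_galg F n) : Prop :=
  forall P : free_galg F n -> Prop,
    T_ideal P -> (forall g, S g -> P g) -> P f.

Inductive I_n_generator (F : fieldType) n : free_galg F n -> Prop :=
| I_n_comm :
    I_n_generator (gX F 0 1 * gX F 0 2 - gX F 0 2 * gX F 0 1)
| I_n_swap (t : 'I_n.+1) :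
    I_n_generator (gX F t 1 * gX F (- t) 2 * gX F t 3
                   - gX F t 3 * gX F (- t) 2 * gX F t 1).

Definition I_n (F : fieldType) n : free_galg F n -> Prop :=
  T_ideal_gen (@I_n_generator F n).

(* The span of the e_ij with j - i = t in 'I_n.+1. *)
Definition mx_component (F : fieldType) n (t : 'I_n.+1) :
    {vspace 'M[F]_n.+1} :=
  (\sum_(p : 'I_n.+1 * 'I_n.+1 | (p.2 - p.1 == t)%R)
     <[delta_mx p.1 p.2 : 'M[F]_n.+1]>)%VS.

Definition graded_subspace (F : fieldType) n (A : {vspace 'M[F]_n.+1}) : Prop :=
  A = (\sum_(t : 'I_n.+1) (A :&: mx_component F t))%VS.

(* A is the smallest multiplicatively closed subspace containing some set of
   elementary matrices, i.e. the span of the nonempty products of these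
   matrices.  The unit is not adjoined for free: an {aspace _} has an identity
   element by definition, but this element has to come from the generators.
   (agenv, which always adjoins 1, is therefore not used here.) *)
Definition generated_by_elementary (F : fieldType) n
    (A : {aspace 'M[F]_n.+1}) : Prop :=
  exists S : {set 'I_n.+1 * 'I_n.+1},
    (forall p, p \in S -> delta_mx p.1 p.2 \in A) /\
    (forall U : {vspace 'M[F]_n.+1},
       (forall p, p \in S -> delta_mx p.1 p.2 \in U) ->
       (U * U <= U)%VS -> (A <= U)%VS).

Definition eval (F : fieldType) n (B : algType F) (a : gvar n -> B)
    (f : free_galg F n) : B :=
  mmap (in_alg B)
       (fun w : {fmonom gvar n} => \prod_(x <- (w : seq (gvar n))) a x) f.

(* Evaluation takes place in the algebra subvs_of A, whose unit is the identity
   element algid A; it is 1%:M as soon as 1%:M lies in A. *)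
Definition graded_identity (F : fieldType) n (A : {aspace 'M[F]_n.+1})
    (f : free_galg F n) : Prop :=
  forall a : gvar n -> subvs_of A,
    (forall x, vsval (a x) \in mx_component F x.1) -> eval a f = 0.

Definition monomial_identity (F : fieldType) n (A : {aspace 'M[F]_n.+1})
    (f : free_galg F n) : Prop :=
  (exists w : {fmonom gvar n}, f = << w >>) /\ graded_identity A f.

(* Main.v *)
From HB Require Import structures.
From mathcomp Require Import finmap.
Require Import Defs.

(** Evaluate a word at a generic homogeneous element of A: the row i of the
    value has a single possibly nonzero entry, a monomial in the generic matrix
    entries.  It records the walk that starts at i and whose successive steps
    are the degrees of the letters, each letter labelling one edge, and it
    vanishes unless every edge of the walk is a matrix unit of A.  The monomial
    is commutative, so it remembers exactly the multiset of labelled edges.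

    The combinatorial heart is [congr_I_n_perm_edges]: two words whose walks
    from one vertex i have the same multiset of labelled edges are congruent
    modulo I_n.  Two such walks are Eulerian trails of the same labelled
    multigraph.  If they differ in the first letter x, the second trail runs
    through a closed walk p before it uses x; by connectivity of the first trail
    ([walks_meet]) p and the rest of the second trail share a vertex, and
    cutting both there exhibits three consecutive blocks of degrees t, -t, t,
    which the second identity of I_n reverses.  This brings x to the front.

    Given an identity f and a word w0 of its support, either no walk of w0 lies
    in A, and then w0 is a monomial identity ([graded_identity_no_walk]), or
    some walk does, from a vertex i say.  In the second case the coefficients of
    the words with the same edges as w0 add up to the coefficient of one
    monomial in a generic entry, hence to zero ([sum_coeff_same_edges]), so that
    the part of f carried by these words is a combination of differences that
    lie in I_n.
    In both cases a part of f containing w0 is a consequence of I_n and of the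
    monomial identities; it is itself an identity, hence so is the rest of f,
    which has smaller support, and induction applies.

    Generic entries are not adjoined to F.  They are replaced by powers of one
    scalar z with exponents 1, B, B^2, and so on: for B large, distinct
    multisets of edges give distinct powers of z ([kronecker_weight_inj]), and
    a polynomial in z that vanishes on a field of characteristic zero is zero.

    The converse inclusion holds since the identities of A form a T-ideal and
    the two identities of I_n only permute the edges of every walk. *)

Set Implicit Arguments.
Unset Strict Implicit.
Unset Printing Implicit Defensive.

Import GRing.Theory.
Local Open Scope ring_scope.

(** * Monoid algebras and their morphisms *)

Section MonoidAlgebra.
Variables (K : monomType) (R : comNzRingType).
Implicit Types (f g : {malg R[K]}) (k l : K).

Lemma malg_scaleAr (c : R) f g : c *: (f * g) = f * (c *: g).
Proof.
rewrite -[c *: (f * g)]mul_malgC -[c *: g]mul_malgC !mulrA; congr (_ * g).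
rewrite mul_malgC malgZ_def malgM_def fgmulgU.
by apply: eq_bigr => w _; rewrite mulm1 mulrC.
Qed.

Lemma malgU_scale (c : R) k : << c *g k >> = c *: << k >> :> {malg R[K]}.
Proof. by apply/malgP => l; rewrite mcoeffZ !mcoeffU mulr_natr. Qed.

Lemma malg_sumE f : f = \sum_(k <- msupp f) f@_k *: << k >>.
Proof. by rewrite [LHS]monalgE; apply: eq_bigr => k _; rewrite malgU_scale. Qed.

Lemma malgUM k l : << k >> * << l >> = << mmul k l >> :> {malg R[K]}.
Proof. by rewrite malgM_def fgmulUU mulr1. Qed.

(** The compatibility of scaling with the right factor is a hypothesis rather
    than part of the structure of B, so that the target may also be the monoid
    algebra itself, an [lalgType] that satisfies it by [malg_scaleAr]. *)
Section Extension.
Variables (B : lalgType R) (h : K -> B).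
Hypothesis scaleAr : forall (c : R) (x y : B), c *: (x * y) = x * (c *: y).
Hypotheses (h1 : h mone = 1) (hM : {morph h : k l / mmul k l >-> k * l}).

Lemma mmap_alg_linear : linear (mmap (in_alg B) h).
Proof.
move=> c f g; rewrite mmapD (mmapEw (msuppZ_le _ _)) mmapE scaler_sumr.
congr (_ + _); apply: eq_bigr => k _.
by rewrite mcoeffZ /= !mulr_algl scalerA.
Qed.

Lemma mmap_alg_monoid_morphism : monoid_morphism (mmap (in_alg B) h).
Proof.
split=> [|f g]; first by rewrite mmapU /= scale1r h1 mulr1.
rewrite malgME raddf_sum mulr_suml /=; apply: eq_bigr => k _.
rewrite raddf_sum mulr_sumr /=; apply: eq_bigr => l _.
by rewrite mmapU /= !mulr_algl hM -scalerAl -scaleAr scalerA.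
Qed.
End Extension.

End MonoidAlgebra.

Lemma sum_scaleB_const (R : nzRingType) (V : lmodType R) (I : Type) (r : seq I)
    (P : pred I) (c : I -> R) (v : I -> V) (v0 : V) :
  \sum_(i <- r | P i) c i = 0 ->
  \sum_(i <- r | P i) c i *: (v i - v0) = \sum_(i <- r | P i) c i *: v i.
Proof.
move=> c0; under eq_bigr => i _ do rewrite scalerBr.
by rewrite sumrB -scaler_suml c0 scale0r subr0.
Qed.

(** * Words in the free graded algebra *)

(** Locked, so that conversion compares two words letter by letter instead of
    unfolding the finitely supported functions that represent them. *)
HB.lock Definition word (F : fieldType) n (w : seq (gvar n)) : free_galg F n :=
  << FMonom w >>.
Arguments word {F n} w.

Section FreeAlgebra.
Variables (F : fieldType) (n : nat).
Local Notation FX := (free_galg F n).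
Implicit Types (u v w : seq (gvar n)) (f g : FX).

Local Notation word := (@word F n).

Lemma wordE w : word w = << FMonom w >>. Proof. by rewrite word.unlock. Qed.

Definition word_deg w : 'I_n.+1 := \sum_(x <- w) x.1.

Lemma word0 : word [::] = 1.
Proof. by rewrite !wordE -fm1 fmK. Qed.

Lemma word1 x : word [:: x] = << fmu x >>.
Proof. by rewrite wordE fmuE. Qed.

Lemma word_cat u v : word (u ++ v) = word u * word v.
Proof.
rewrite !wordE malgUM; congr mkmalgU.
by apply/eqP; rewrite fmP fmM.
Qed.

Lemma mcoeff_word u (w : {fmonom gvar n}) : (word u)@_w = (u == w)%:R.
Proof. by rewrite wordE mcoeffU1 fmP. Qed.

Lemma free_galg_sumE f : f = \sum_(w <- msupp f) f@_w *: word w.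
Proof.
by rewrite [LHS]malg_sumE; apply: eq_bigr => w _; rewrite !wordE fmK.
Qed.

Lemma word_deg_cat u v : word_deg (u ++ v) = word_deg u + word_deg v.
Proof. exact: big_cat. Qed.

Lemma word_deg_cons x v : word_deg (x :: v) = x.1 + word_deg v.
Proof. exact: big_cons. Qed.

Definition letters_prod (B : pzRingType) (a : gvar n -> B)
    (w : {fmonom gvar n}) : B :=
  \prod_(x <- (w : seq (gvar n))) a x.

Lemma letters_prod1 (B : pzRingType) (a : gvar n -> B) :
  letters_prod a mone = 1.
Proof. by rewrite /letters_prod fm1 big_nil. Qed.

Lemma letters_prodM (B : pzRingType) (a : gvar n -> B) :
  {morph letters_prod a : k l / mmul k l >-> k * l}.
Proof. by move=> k l; rewrite /letters_prod fmM big_cat. Qed.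

Section Eval.
Variables (B : algType F) (a : gvar n -> B).
HB.instance Definition _ := GRing.isLinear.Build F FX B _ (eval a)
  (mmap_alg_linear (letters_prod a)).
HB.instance Definition _ := GRing.isMonoidMorphism.Build FX B (eval a)
  (mmap_alg_monoid_morphism (@scalerAr F B)
    (letters_prod1 a) (letters_prodM a)).

Lemma evalE f : eval a f =
  \sum_(w <- msupp f) f@_w *: \prod_(x <- (w : seq (gvar n))) a x.
Proof. by rewrite /eval mmapE; apply: eq_bigr => w _; rewrite /= mulr_algl. Qed.

Lemma eval_word w : eval a (word w) = \prod_(x <- w) a x.
Proof. by rewrite /eval wordE mmapU /= scale1r mul1r. Qed.
End Eval.

Section Substitution.
Variable a : gvar n -> FX.
Definition substitute : FX -> FX := mmap (in_alg FX) (letters_prod a).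

HB.instance Definition _ := GRing.isLinear.Build F FX FX _ substitute
  (mmap_alg_linear (letters_prod a)).
HB.instance Definition _ := GRing.isMonoidMorphism.Build FX FX substitute
  (mmap_alg_monoid_morphism (@malg_scaleAr _ _)
    (letters_prod1 a) (letters_prodM a)).

Lemma substitute_word w : substitute (word w) = \prod_(x <- w) a x.
Proof. by rewrite /substitute !wordE mmapU /= scale1r mul1r. Qed.
End Substitution.

Lemma homogeneousD t f g :
  homogeneous t f -> homogeneous t g -> homogeneous t (f + g).
Proof.
move=> hf hg w; rewrite mcoeffD; have [f0|/hf //] := eqVneq (f@_w) 0.
by rewrite f0 add0r => /hg.
Qed.

Lemma homogeneousZ t c f : homogeneous t f -> homogeneous t (c *: f).
Proof.
move=> hf w; rewrite mcoeffZ => nz; apply: hf; apply: contraNneq nz => ->.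
by rewrite mulr0.
Qed.

Lemma homogeneous_word w : homogeneous (word_deg w) (word w).
Proof.
move=> v; rewrite mcoeff_word; case: (w =P v :> seq _) => [-> //|_].
by rewrite eqxx.
Qed.

Lemma homogeneousM s t f g :
  homogeneous s f -> homogeneous t g -> homogeneous (s + t) (f * g).
Proof.
move=> hf hg w; rewrite mcoeff_neq0 => /msuppM_le [u [v]].
rewrite -!mcoeff_neq0 => -[/hf <- /hg <- ->].
by rewrite /mon_deg fmM big_cat.
Qed.

Lemma graded_endo_substitute (a : gvar n -> FX) :
  (forall x, homogeneous x.1 (a x)) -> graded_endo (substitute a).
Proof.
move=> ha t f hf; rewrite [f]free_galg_sumE raddf_sum /=.
have aux (s : seq {fmonom gvar n}) : {subset s <= msupp f} ->
    homogeneous t (\sum_(w <- s) substitute a (f@_w *: word w)).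
  elim: s => [|w s IH] sf; first by move=> w; rewrite big_nil mcoeff0 eqxx.
  rewrite big_cons; apply: homogeneousD; last first.
    by apply: IH => v vs; apply: sf; rewrite inE vs orbT.
  have <-: mon_deg w = t.
    by apply: hf; rewrite mcoeff_neq0; apply: sf; rewrite mem_head.
  rewrite linearZ /=; apply: homogeneousZ.
  rewrite substitute_word /mon_deg; elim: (w : seq _) => [|x v IHv].
    have := @homogeneous_word [::].
    by rewrite word0 /word_deg !big_nil.
  by rewrite !big_cons; apply: homogeneousM.
exact: aux.
Qed.

Lemma T_ideal_substitute (P : FX -> Prop) (a : gvar n -> FX) f :
  T_ideal P -> (forall x, homogeneous x.1 (a x)) -> P f -> P (substitute a f).
Proof.
by move=> [_ TP] ha; apply: (TP (substitute a) (graded_endo_substitute ha)).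
Qed.

Lemma T_ideal_gen_T_ideal (S : FX -> Prop) : T_ideal (T_ideal_gen S).
Proof.
split; first split.
- by move=> P [[]].
- move=> f g hf hg P PT PS; case: (PT) => -[_ PD _ _] _.
  by apply: PD; [apply: hf|apply: hg].
- by move=> f g hg P PT PS; case: (PT) => -[_ _ PM _] _; apply: PM; apply: hg.
- by move=> f g hg P PT PS; case: (PT) => -[_ _ _ PM] _; apply: PM; apply: hg.
- by move=> phi gphi f hf P PT PS; case: (PT) => _; apply => //; apply: hf.
Qed.

Section Ideal.
Variables (P : FX -> Prop).
Hypothesis idP : is_ideal P.

Lemma idealZ c f : P f -> P (c *: f).
Proof. by case: idP => _ _ PM _ Pf; rewrite -mulr_algl; apply: PM. Qed.

Lemma idealN f : P f -> P (- f).
Proof. by rewrite -scaleN1r; apply: idealZ. Qed.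

Lemma ideal_sum (I : Type) (s : seq I) (C : pred I) (G : I -> FX) :
  (forall i, C i -> P (G i)) -> P (\sum_(i <- s | C i) G i).
Proof. by case: idP => P0 PD _ _ h; elim/big_rec: _ => // i g /h; auto. Qed.
End Ideal.

(** * Congruence of words modulo I_n *)

Definition congr_I_n u v := I_n (word u - word v).

Lemma I_n_ideal : is_ideal (@I_n F n).
Proof. by case: (T_ideal_gen_T_ideal (@I_n_generator F n)). Qed.

Lemma congr_I_n_refl u : congr_I_n u u.
Proof. by rewrite /congr_I_n subrr; case: I_n_ideal. Qed.

Lemma congr_I_n_trans v u w : congr_I_n u v -> congr_I_n v w -> congr_I_n u w.
Proof.
rewrite /congr_I_n => uv vw; case: I_n_ideal => _ PD _ _.
by have := PD _ _ uv vw; rewrite addrA subrK.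
Qed.

Lemma congr_I_n_sym u v : congr_I_n u v -> congr_I_n v u.
Proof.
by move=> uv; rewrite /congr_I_n -opprB; apply: idealN I_n_ideal _ _.
Qed.

Lemma congr_I_n_catl u v w : congr_I_n v w -> congr_I_n (u ++ v) (u ++ w).
Proof.
rewrite /congr_I_n !word_cat -mulrBr.
by case: I_n_ideal => _ _ PM _; apply: PM.
Qed.

Lemma congr_I_n_catr u v w : congr_I_n u v -> congr_I_n (u ++ w) (v ++ w).
Proof.
rewrite /congr_I_n !word_cat -mulrBl.
by case: I_n_ideal => _ _ _; apply.
Qed.

(** The three variables of the second generator of I_n are replaced by u, v and
    w.  A word of degree 0 may be empty, so the case of an empty v yields the
    commutation of two words of degree 0. *)
Lemma congr_I_n_swap u v w :
    word_deg u = word_deg w -> word_deg v = - word_deg w ->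
  congr_I_n (u ++ v ++ w) (w ++ v ++ u).
Proof.
move=> du dv; set t := word_deg w in du dv.
(* The indices 1, 2, 3 keep the variables apart even if t = - t. *)
pose a (x : gvar n) : FX :=
  if x == (t, 1%N) then word u else
  if x == (- t, 2%N) then word v else
  if x == (t, 3%N) then word w else word [:: x].
have ha x : homogeneous x.1 (a x).
  rewrite /a; case: eqP => [->|_].
    by rewrite -du; apply: homogeneous_word.
  case: eqP => [->|_]; first by rewrite -dv; apply: homogeneous_word.
  case: eqP => [->|_]; first by apply: homogeneous_word.
  have := @homogeneous_word [:: x].
  by rewrite /word_deg big_seq1.
have : I_n (word [:: (t, 1%N); (- t, 2%N); (t, 3%N)]
            - word [:: (t, 3%N); (- t, 2%N); (t, 1%N)]).
  have EgX s1 k1 s2 k2 s3 k3 :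
      word [:: (s1, k1); (s2, k2); (s3, k3)]
      = gX F s1 k1 * gX F s2 k2 * gX F s3 k3.
    by rewrite /gX -!word1 -!word_cat.
  by rewrite 2!(EgX t _ (- t)) => P _ PS; apply: PS; apply: I_n_swap.
move=> /(T_ideal_substitute (T_ideal_gen_T_ideal (@I_n_generator F n)) ha).
rewrite raddfB /= !substitute_word !big_cons big_nil.
rewrite /a !xpair_eqE !eqxx /= !andbF /=.
by rewrite !mulr1 -!word_cat.
Qed.

End FreeAlgebra.

(** * Walks of words *)

Section Walks.
Variable n : nat.
Implicit Types (i j k : 'I_n.+1) (u v w p q : seq (gvar n)) (x : gvar n).

(** The trail of w from the vertex i of the cyclic group: the edge (j, x) leads
    from j to j + x.1 and corresponds to the entry (j, j + x.1) of the matrix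
    that is substituted for x. *)
Fixpoint edges i w : seq ('I_n.+1 * gvar n) :=
  if w is x :: w' then (i, x) :: edges (i + x.1) w' else [::].

Lemma size_edges i w : size (edges i w) = size w.
Proof. by elim: w i => //= x w IH i; rewrite IH. Qed.

Lemma edges_cat i u v :
  edges i (u ++ v) = edges i u ++ edges (i + word_deg u) v.
Proof.
elim: u i => [|x u IH] i /=; first by rewrite /word_deg big_nil addr0.
by rewrite IH word_deg_cons addrA.
Qed.

Lemma mem_edges i w k x : (k, x) \in edges i w ->
  exists u v, w = u ++ x :: v /\ i + word_deg u = k.
Proof.
elim: w i => //= y w IH i; rewrite inE => /predU1P[[-> ->]|/IH[u [v [-> <-]]]].
  by exists [::], w; rewrite /word_deg big_nil addr0.
by exists (y :: u), v; rewrite word_deg_cons addrA.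
Qed.

Lemma perm_edges_word_deg i u v :
  perm_eq (edges i u) (edges i v) -> word_deg u = word_deg v.
Proof.
have edgesE w j : word_deg w = \sum_(e <- edges j w) e.2.1.
  elim: w j => [|x w IH] j; first by rewrite /word_deg !big_nil.
  by rewrite /= word_deg_cons big_cons -IH.
by move=> uv; rewrite (edgesE u i) (edgesE v i); apply: perm_big.
Qed.

Definition visited i w : seq 'I_n.+1 :=
  [seq i + word_deg (take m w) | m <- iota 0 (size w).+1].

Lemma visitedP i w k :
  reflect (exists u v, w = u ++ v /\ k = i + word_deg u) (k \in visited i w).
Proof.
apply: (iffP mapP) => [[m _ ->]|[u [v [-> ->]]]].
  by exists (take m w), (drop m w); rewrite cat_take_drop.
exists (size u); last by rewrite take_size_cat.
by rewrite mem_iota /= add0n ltnS size_cat leq_addr.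
Qed.

Lemma source_visited i w e : e \in edges i w -> e.1 \in visited i w.
Proof.
case: e => k x /mem_edges[u [v [-> <-]]]; apply/visitedP.
by exists u, (x :: v).
Qed.

Lemma target_visited i w e : e \in edges i w -> e.1 + e.2.1 \in visited i w.
Proof.
case: e => k x /mem_edges[u [v [-> <-]]]; apply/visitedP.
exists (rcons u x), v; rewrite cat_rcons -cats1 word_deg_cat addrA.
by rewrite /word_deg big_seq1.
Qed.

(** A walk cannot leave a set of vertices that is stable along its own edges. *)
Lemma edges_closed (P : pred 'I_n.+1) i w : P i ->
    (forall e, e \in edges i w -> P e.1 -> P (e.1 + e.2.1)) ->
  forall e, e \in edges i w -> P e.1.
Proof.
elim: w i => //= x w IH i Pi h e; rewrite inE => /predU1P[-> //|].
apply: IH; first by apply: (h (i, x)) => //; rewrite mem_head.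
by move=> e' e'w; apply: h; rewrite inE e'w orbT.
Qed.

(** The walk from i runs through u to j := i + word_deg u, through v back to i
    and through w to j again, so u and w are both traversed from i to j and may
    be exchanged. *)
Lemma perm_edges_swap i u v w t :
    word_deg u = word_deg w -> word_deg v = - word_deg w ->
  perm_eq (edges i (u ++ v ++ w ++ t)) (edges i (w ++ v ++ u ++ t)).
Proof.
move=> du dv; rewrite !edges_cat du dv addrK; apply/permP => P.
by rewrite !count_cat !addnA; congr (_ + _)%N; rewrite addnC addnCA addnC.
Qed.

(** Otherwise the two vertex sets are disjoint, and w, which starts at the same
    vertex as q and only uses edges of p and q, stays among the vertices of q.
    It then never uses the first edge of p, although that edge occurs in w. *)
Lemma walks_meet i x w p q : p != [::] ->
    perm_eq ((i, x) :: edges (i + x.1) w)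
            (edges i p ++ (i, x) :: edges (i + x.1) q) ->
  exists2 k, k \in visited i p & k \in visited (i + x.1) q.
Proof.
move=> p0; rewrite perm_sym perm_catC /= perm_cons perm_sym => wpq.
have memw e : (e \in edges (i + x.1) w)
    = (e \in edges (i + x.1) q) || (e \in edges i p).
  by rewrite (perm_mem wpq) mem_cat.
apply/hasP; apply: contraT => /hasPn disj.
have inq : forall e, e \in edges (i + x.1) w -> e.1 \in visited (i + x.1) q.
  apply: edges_closed => [|e].
    by apply/visitedP; exists [::], q; rewrite /word_deg big_nil addr0.
  rewrite memw => /orP[/target_visited //|/source_visited ep eq].
  by have /negP[] := disj _ ep.
case: p p0 {wpq} memw disj => // y p _ memw /(_ i) disj.
have /inq /= iq : (i, y) \in edges (i + x.1) w by rewrite memw /= mem_head orbT.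
suff /disj/negP[] : i \in visited i (y :: p) by [].
by apply/visitedP; exists [::], (y :: p); rewrite /word_deg big_nil addr0.
Qed.

End Walks.

(** The letter x that comes first in u is moved to the front of v = p x q.  Here
    p is closed, since x is read at the vertex i both in u and in v; a common
    vertex k of p and q splits v as p1, p2, x q1, q2 where p1 and x q1 lead
    from i to k and p2 leads back. *)
Lemma congr_I_n_perm_edges (F : fieldType) n i (u v : seq (gvar n)) :
  perm_eq (edges i u) (edges i v) -> congr_I_n F u v.
Proof.
elim: u i v => [|x w IH] i v uv.
  have /size0nil -> : size v = 0%N by rewrite -(size_edges i) -(perm_size uv).
  exact: congr_I_n_refl.
suff [r vr vrE] : exists2 r, congr_I_n F v (x :: r)
    & perm_eq (edges i v) (edges i (x :: r)).
  apply: congr_I_n_trans (congr_I_n_sym vr); apply: (congr_I_n_catl [:: x]).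
  apply: (IH (i + x.1)); rewrite -(perm_cons (i, x)).
  exact: perm_trans uv vrE.
have /mem_edges[p [q [vE dp]]] : (i, x) \in edges i v.
  by rewrite -(perm_mem uv) mem_head.
have {}dp : word_deg p = 0 by apply: (addrI i); rewrite addr0.
have [p0|p_neq0] := eqVneq p [::].
  by exists q; rewrite vE p0 //; apply: congr_I_n_refl.
have [k] : exists2 k, k \in visited i p & k \in visited (i + x.1) q.
  apply: (walks_meet p_neq0); move: uv.
  by rewrite vE edges_cat dp addr0; apply: id.
move=> /visitedP[p1 [p2 [pE k1]]] /visitedP[q1 [q2 [qE k2]]].
have d1 : word_deg p1 = word_deg (x :: q1).
  by apply: (addrI i); rewrite -k1 k2 word_deg_cons addrA.
have d2 : word_deg p2 = - word_deg (x :: q1).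
  by apply: (addrI (word_deg p1)); rewrite -word_deg_cat -pE dp d1 subrr.
have {}vE : v = p1 ++ p2 ++ (x :: q1) ++ q2 by rewrite vE pE qE -catA.
exists (q1 ++ p2 ++ p1 ++ q2); rewrite vE; last exact: perm_edges_swap.
by have := congr_I_n_catr q2 (@congr_I_n_swap F _ _ _ _ d1 d2); rewrite -!catA.
Qed.

(** * Separating multisets by one scalar *)

Section Kronecker.
Variable T : countType.
Implicit Types s : seq T.

(** Kronecker substitution: this number has the multiplicities in s as its
    digits in base B, as soon as they are smaller than B. *)
Definition kronecker_weight B s := (\sum_(v <- s) B ^ pickle v)%N.

Lemma digits_inj B K (m m' : nat -> nat) :
    (forall i, m i < B)%N -> (forall i, m' i < B)%N ->
    (\sum_(i < K) m i * B ^ i = \sum_(i < K) m' i * B ^ i)%N ->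
  forall i, (i < K)%N -> m i = m' i.
Proof.
elim: K m m' => // K IH m m' mB m'B.
have shift (f : nat -> nat) : (\sum_(i < K.+1) f i * B ^ i
    = (\sum_(i < K) f i.+1 * B ^ i) * B + f 0)%N.
  rewrite big_ord_recl muln1 addnC big_distrl /=; congr (_ + _)%N.
  by apply: eq_bigr => i _; rewrite -mulnA -expnSr.
rewrite !shift => eqm.
have eq0 : m 0%N = m' 0%N.
  by have := congr1 (modn^~ B) eqm; rewrite /= !modnMDl !modn_small.
case=> [//|i]; rewrite ltnS => iK.
apply: (IH (m \o succn) (m' \o succn)) => //=; try by move=> j.
have B0 : (0 < B)%N by apply: leq_ltn_trans (mB 0%N).
by have := congr1 (divn^~ B) eqm; rewrite /= !divnMDl // !divn_small // !addn0.
Qed.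

Lemma kronecker_weightE B K s : (forall v, v \in s -> pickle v < K)%N ->
  kronecker_weight B s
  = (\sum_(i < K) count (fun v => pickle v == i) s * B ^ i)%N.
Proof.
elim: s => [|v s IH] sK; rewrite /kronecker_weight.
  by rewrite big_nil big1.
rewrite big_cons -/(kronecker_weight B s) IH => [|u us]; last first.
  by apply: sK; rewrite inE us orbT.
under [RHS]eq_bigr => i _ do rewrite /= mulnDl.
rewrite big_split /=; congr (_ + _)%N.
rewrite (bigD1 (Ordinal (sK v (mem_head _ _)))) //= eqxx mul1n.
rewrite big1 ?addn0 // => i.
by rewrite -val_eqE /= eq_sym => /negbTE ->.
Qed.

Lemma kronecker_weight_inj B s s' : (size s < B)%N -> (size s' < B)%N ->
  kronecker_weight B s = kronecker_weight B s' -> perm_eq s s'.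
Proof.
move=> sB s'B; pose K := (\max_(v <- s ++ s') pickle v).+1.
have ssK v : v \in s ++ s' -> (pickle v < K)%N.
  by move=> vs; rewrite ltnS; apply: leq_bigmax_seq.
have sK v : v \in s -> (pickle v < K)%N by move=> vs; rewrite ssK ?mem_cat ?vs.
have s'K v : v \in s' -> (pickle v < K)%N.
  by move=> vs; rewrite ssK ?mem_cat ?vs ?orbT.
rewrite (kronecker_weightE B sK) (kronecker_weightE B s'K).
move=> /(@digits_inj _ _ (fun i => count (fun v => pickle v == i) s)
   (fun i => count (fun v => pickle v == i) s')) eqc.
apply/allP => v vs /=; apply/eqP.
have countE t : count_mem v t = count (fun u => pickle u == pickle v) t.
  by apply: eq_count => u /=; rewrite (inj_eq (pcan_inj pickleK)).
by rewrite !countE eqc ?ssK // => i; apply: leq_ltn_trans (count_size _ _) _.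
Qed.

End Kronecker.

Lemma poly_eq0_char0 (F : fieldType) (q : {poly F}) :
  [pchar F] =i pred0 -> (forall z, q.[z] = 0) -> q = 0.
Proof.
move=> /pcharf0P charF0 q0; apply/eqP; apply: contraT => nz.
have := @max_poly_roots F q [seq k%:R | k <- iota 0 (size q)] nz.
rewrite size_map size_iota ltnn => -> //.
  by apply/allP => z _; rewrite /root q0.
rewrite map_inj_uniq ?iota_uniq // => k l /eqP.
wlog kl : k l / (k <= l)%N => [hw|].
  by case/orP: (leq_total k l) => [/hw //|/hw h]; rewrite eq_sym => /h.
rewrite eq_sym -subr_eq0 -natrB // charF0 subn_eq0 => lk.
by apply/eqP; rewrite eqn_leq kl lk.
Qed.

(** * Evaluation in an algebra spanned by elementary matrices *)

Section Matrices.
Variables (F : fieldType) (n : nat).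
Implicit Types (i j k l t : 'I_n.+1) (m : 'M[F]_n.+1).

Lemma elementary_spanP (P : pred ('I_n.+1 * 'I_n.+1)) m :
  m \in (\sum_(p | P p) <[delta_mx p.1 p.2 : 'M[F]_n.+1]>)%VS
  <-> (forall i j, m i j != 0 -> P (i, j)).
Proof.
split=> [/memv_sumP[ms msP ->] i j|mP].
  rewrite summxE; apply: contra_neqT => nP; apply: big1 => p Pp.
  have /vlineP[c ->] := msP p Pp; rewrite !mxE.
  case: eqP => [ip|]; last by rewrite mulr0.
  case: eqP => [jp|]; last by rewrite mulr0.
  by case: p Pp ip jp => p1 p2 /= Pp ip jp; rewrite ip jp Pp in nP.
rewrite [m]matrix_sum_delta; apply: memv_suml => i _; apply: memv_suml => j _.
have [->|/mP Pij] := eqVneq (m i j) 0; first by rewrite scale0r mem0v.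
apply: memvZ; apply: (subvP (sumv_sup (i, j) Pij (subvv _))).
exact: memv_line.
Qed.

Lemma mx_componentP t m :
  m \in mx_component F t <-> (forall i j, m i j != 0 -> j - i = t).
Proof.
split=> [/elementary_spanP mP i j /mP/eqP //|mP].
by apply/elementary_spanP => i j /mP /eqP.
Qed.

Lemma mul_delta_mxE m i j k l :
  (m * delta_mx i j) k l = m k i * (l == j)%:R.
Proof.
rewrite -[LHS]/((m *m delta_mx i j) k l) mxE (bigD1 i) //=.
rewrite big1 => [|h /negbTE hi].
  by rewrite !mxE eqxx addr0.
by rewrite !mxE hi mulr0.
Qed.

Lemma delta_mulmxE m i j k l :
  (delta_mx i j * m) k l = (k == i)%:R * m j l.
Proof.
rewrite -[LHS]/((delta_mx i j *m m) k l) mxE (bigD1 j) //=.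
rewrite big1 => [|h /negbTE hi].
  by rewrite !mxE eqxx andbT addr0.
by rewrite !mxE hi andbF mul0r.
Qed.

Variables (A : {aspace 'M[F]_n.+1}) (genA : generated_by_elementary A).
Local Notation E i j := (delta_mx i j : 'M[F]_n.+1).

(** The span of the elementary matrices that lie in A contains the generators
    and is closed under products, so it contains A. *)
Lemma mem_delta_entry m i j : m \in A -> m i j != 0 -> E i j \in A.
Proof.
case: genA => S [SA minA] /(subvP (minA _ _ _)) mA.
pose U := (\sum_(p | E p.1 p.2 \in A) <[E p.1 p.2]>)%VS.
have /elementary_spanP mP : m \in U.
  apply: mA => [p /SA pA|].
    exact: (subvP (sumv_sup p pA (subvv _))) _ (memv_line _).
  apply/prodvP => u v /elementary_spanP uA /elementary_spanP vA.
  apply/elementary_spanP => k l.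
  rewrite -[_ k l]/((u *m v) k l) mxE => /eqP uv.
  have /existsP[h] : [exists h, u k h * v h l != 0].
    apply: contraT => /existsPn h0; case: uv; apply: big1 => h _.
    by apply/eqP; move: (h0 h); rewrite negbK.
  rewrite mulf_eq0 negb_or => /andP[/uA ukh /vA vhl].
  have /(subvP (asubv A)) := memv_mul ukh vhl.
  by rewrite -[_ * _]/(_ *m _) mul_delta_mx.
exact: mP.
Qed.

(** The identity element e of A satisfies e * E i j = E i j = E i j * e, which
    forces its diagonal entries at i and j to be 1.  Thus the matrix units in A
    form a preorder on the indices that occur in them. *)
Lemma mem_delta_diag i j : E i j \in A -> (E i i \in A) /\ (E j j \in A).
Proof.
move=> ijA; have eA := memv_algid A.
have e1 : algid A i i = 1.
  have := congr1 (fun m : 'M_n.+1 => m i j) (algidl ijA).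
  by rewrite mul_delta_mxE !mxE !eqxx !mulr1.
have e2 : algid A j j = 1.
  have := congr1 (fun m : 'M_n.+1 => m i j) (algidr ijA).
  by rewrite delta_mulmxE !mxE !eqxx !mul1r.
by split; apply: mem_delta_entry eA _; rewrite ?e1 ?e2 oner_eq0.
Qed.

Lemma algid_entry i j : algid A i j = ((i == j) && (E i i \in A))%:R.
Proof.
have [ijA|ijA] := boolP (E i j \in A); last first.
  have -> : algid A i j = 0.
    by apply: contraNeq ijA; apply: mem_delta_entry (memv_algid A).
  by case: eqP ijA => // <- /negbTE ->.
have [iiA _] := mem_delta_diag ijA; rewrite iiA andbT.
have := congr1 (fun m : 'M_n.+1 => m i j) (algidr iiA).
by rewrite delta_mulmxE !mxE eqxx mul1r eq_sym.
Qed.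

Section Evaluation.
Variable a : gvar n -> subvs_of A.
Hypothesis homa : forall x, vsval (a x) \in mx_component F x.1.

Definition edge_value (e : 'I_n.+1 * gvar n) : F :=
  vsval (a e.2) e.1 (e.1 + e.2.1).

(** The factor [E i i \in A] matters for the empty word, whose value is the
    identity element of A, which need not be the identity matrix. *)
Lemma prod_word_entry i j (w : seq (gvar n)) :
  vsval (\prod_(x <- w) a x) i j =
  ((j == i + word_deg w) && (E i i \in A))%:R
  * \prod_(e <- edges i w) edge_value e.
Proof.
elim: w i => [|x w IH] i.
  rewrite !big_nil mulr1 /word_deg big_nil addr0 -[vsval 1]/(algid A).
  by rewrite algid_entry eq_sym.
rewrite big_cons -[LHS]/((vsval (a x) *m vsval (\prod_(x <- w) a x)) i j) mxE.
rewrite (bigD1 (i + x.1)) //= [X in _ + X]big1 ?addr0 => [|k ki]; last first.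
  have [->|] := eqVneq (vsval (a x) i k) 0; first by rewrite mul0r.
  by move/mx_componentP: (homa x) => /[apply] ik; rewrite -ik subrKC eqxx in ki.
rewrite IH big_cons word_deg_cons addrA /edge_value /=.
have [->|nz] := eqVneq (vsval (a x) i (i + x.1)) 0.
  by rewrite !mul0r mulr0.
have [-> ->] := mem_delta_diag (mem_delta_entry (subvsP (a x)) nz).
by rewrite mulrCA.
Qed.

Lemma eval_entry f i j : vsval (eval a f) i j =
  \sum_(w <- msupp f) f@_w * ((j == i + word_deg w) && (E i i \in A))%:R
  * \prod_(e <- edges i w) edge_value e.
Proof.
rewrite evalE raddf_sum summxE; apply: eq_bigr => w _.
by rewrite /= mxE prod_word_entry mulrA.
Qed.

Lemma eval_homogeneous t f :
  homogeneous t f -> vsval (eval a f) \in mx_component F t.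
Proof.
move=> hf; apply/mx_componentP => i j; rewrite eval_entry.
apply: contra_neq_eq => ij; rewrite big_seq big1 // => w.
rewrite -mcoeff_neq0 => /hf wt.
case: eqP => [jE|]; last by rewrite mulr0 mul0r.
by rewrite jE -wt -/(word_deg w) addrC addKr eqxx in ij.
Qed.

End Evaluation.

Lemma eval_lrmorphism (a : gvar n -> subvs_of A)
    (phi : {lrmorphism free_galg F n -> free_galg F n}) f :
  eval a (phi f) = eval (fun x => eval a (phi (word [:: x]))) f.
Proof.
rewrite [RHS]evalE [in LHS](free_galg_sumE f) linear_sum linear_sum.
apply: eq_bigr => w _ /=; rewrite !linearZ /=; congr (_ *: _).
elim: (w : seq _) => [|x v IH].
  by rewrite big_nil word0 !rmorph1.
by rewrite big_cons -IH -cat1s word_cat !rmorphM.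
Qed.

Lemma graded_identity_T_ideal : T_ideal (graded_identity A).
Proof.
split; first split.
- by move=> a _; rewrite raddf0.
- by move=> f g hf hg a ha; rewrite raddfD /= hf ?hg ?addr0.
- by move=> f g hg a ha; rewrite rmorphM /= hg ?mulr0.
- by move=> f g hg a ha; rewrite rmorphM /= hg ?mul0r.
- move=> phi gphi f hf a ha; rewrite eval_lrmorphism; apply: hf => x.
  apply: eval_homogeneous => //; apply: gphi.
  have := @homogeneous_word F n [:: x].
  by rewrite /word_deg big_seq1.
Qed.

Lemma graded_identity_word_sub (u v : seq (gvar n)) :
  (forall i, perm_eq (edges i u) (edges i v)) ->
  graded_identity A (word u - word v).
Proof.
move=> uv a ha; rewrite raddfB /= !eval_word; apply/eqP; rewrite subr_eq0.
apply/eqP/val_inj/matrixP => i j.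
rewrite -![val _]/(vsval _) !prod_word_entry // (perm_edges_word_deg (uv i)).
by rewrite (perm_big _ (uv i)).
Qed.

Lemma I_n_graded_identity f : I_n f -> graded_identity A f.
Proof.
apply; first exact: graded_identity_T_ideal.
move=> _ [|t]; rewrite /gX -!word1 -!word_cat;
  apply: graded_identity_word_sub => i /=.
  by rewrite !addr0 (perm_catC [:: _] [:: _]).
by apply/permP => P /=; rewrite !addrK !addn0 addnC -addnA addnCA.
Qed.

End Matrices.

(** * Generic evaluation and the coefficients of an identity *)

Section GenericEvaluation.
Variables (F : fieldType) (n : nat).
Variables (A : {aspace 'M[F]_n.+1}) (genA : generated_by_elementary A).
Local Notation E i j := (delta_mx i j : 'M[F]_n.+1).
Implicit Types (i j : 'I_n.+1) (u v w : seq (gvar n)).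

Definition edge_in (e : 'I_n.+1 * gvar n) := E e.1 (e.1 + e.2.1) \in A.

Definition walk_in i w := (E i i \in A) && all edge_in (edges i w).

(** The generic homogeneous element of A of degree x.1, with powers of z in
    place of independent entries. *)
Definition kronecker_point B (z : F) (x : gvar n) : subvs_of A :=
  \sum_(i | edge_in (i, x))
    z ^+ (B ^ pickle (i, x)) *: vsproj A (E i (i + x.1)).

Lemma kronecker_point_entry B z x i j : vsval (kronecker_point B z x) i j =
  ((j == i + x.1) && edge_in (i, x))%:R * z ^+ (B ^ pickle (i, x)).
Proof.
rewrite /kronecker_point raddf_sum summxE /=.
under eq_bigr => k kA do rewrite vsprojK // !mxE.
have [ix|/negbTE ix] := boolP (edge_in (i, x)); last first.
  rewrite andbF mul0r big1 // => k kA.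
  by have [ik|] := eqVneq i k; [rewrite ik kA in ix|rewrite mulr0].
rewrite (bigD1 i) //= eqxx big1 ?addr0 => [|k /andP[_ /negbTE]]; last first.
  by rewrite eq_sym => ->; rewrite mulr0.
by rewrite andbT mulrC.
Qed.

Lemma kronecker_point_component B z x :
  vsval (kronecker_point B z x) \in mx_component F x.1.
Proof.
apply/mx_componentP => i j; rewrite kronecker_point_entry.
have [->|_] := eqVneq j (i + x.1); first by rewrite addrC addKr.
by rewrite mul0r eqxx.
Qed.

Lemma prod_edge_value B z i w :
  \prod_(e <- edges i w) edge_value (kronecker_point B z) e =
  (all edge_in (edges i w))%:R * z ^+ kronecker_weight B (edges i w).
Proof.
rewrite /kronecker_weight; elim: (edges i w) => [|[j x] s IH].
  by rewrite !big_nil mulr1.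
rewrite !big_cons IH /edge_value kronecker_point_entry /= eqxx /=.
by rewrite exprD mulrACA -natrM mulnb.
Qed.

(** At the Kronecker points, the entry of f at row i and column i + word_deg w0
    is a polynomial q in z.  It vanishes on F, so it is zero, and the sum is the
    coefficient of q at the exponent of the walk of w0. *)
Lemma sum_coeff_same_edges (charF0 : [pchar F] =i pred0) f i w0 :
  graded_identity A f -> walk_in i w0 ->
  \sum_(w <- msupp f | perm_eq (edges i w0) (edges i w)) f@_w = 0.
Proof.
move=> idf w0A; set j := i + word_deg w0.
(* Larger than every walk involved, hence than every multiplicity. *)
pose B := (maxn (size w0) (\max_(w <- msupp f) size w)).+1.
have B0 : (size (edges i w0) < B)%N by rewrite size_edges ltnS leq_maxl.
have Bw (w : {fmonom gvar n}) : w \in msupp f -> (size (edges i w) < B)%N.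
  move=> wf; rewrite size_edges ltnS; apply: leq_trans (leq_maxr _ _).
  exact: leq_bigmax_seq.
pose N w := kronecker_weight B (edges i w).
pose C w := (word_deg w == word_deg w0) && walk_in i w.
pose q := \sum_(w <- msupp f | C w) f@_w *: 'X^(N w) : {poly F}.
have q0 : q = 0.
  apply: (poly_eq0_char0 charF0) => z.
  have := idf _ (kronecker_point_component B z).
  move=> /(congr1 (fun m : subvs_of A => vsval m i j)).
  rewrite (eval_entry genA) => [|x]; last exact: kronecker_point_component.
  rewrite raddf0 mxE => f0; rewrite -[RHS]f0 /q horner_sum big_mkcond /=.
  apply: eq_bigr => w _; rewrite prod_edge_value hornerZ hornerXn /j.
  rewrite (inj_eq (addrI i)) /C /walk_in eq_sym -/(N w).
  case: (_ == _) => /=; last by rewrite mulr0 mul0r.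
  case: (_ \in A) => /=; last by rewrite mulr0 mul0r.
  by case: all; rewrite ?mul0r ?mul1r ?mulr0 // mulr1.
have := congr1 (fun p : {poly F} => p`_(N w0)) q0.
rewrite coef0 coef_sum => qN.
rewrite -[RHS]qN [RHS]big_mkcond [LHS]big_mkcond /=.
rewrite [LHS]big_seq [RHS]big_seq; apply: eq_bigr => w wf.
rewrite coefZ coefXn; have [w0w|] := boolP (perm_eq _ _).
  have -> : C w.
    rewrite /C (perm_edges_word_deg w0w) eqxx /walk_in -(perm_all _ w0w).
    exact: w0A.
  by rewrite /N /kronecker_weight (perm_big _ w0w) eqxx mulr1.
case: ifP => // _; case: eqP => [eqN|]; last by rewrite mulr0.
by rewrite (kronecker_weight_inj B0 (Bw w wf) eqN).
Qed.

Lemma graded_identity_no_walk w :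
  (forall i, ~~ walk_in i w) -> graded_identity A (word w).
Proof.
move=> noW a ha; rewrite eval_word; apply/val_inj/matrixP => i j.
rewrite -[val _]/(vsval _) (prod_word_entry genA) // raddf0 mxE.
have := noW i; rewrite /walk_in negb_and => /orP[/negbTE ->|].
  by rewrite andbF mul0r.
case/allPn => e ew /negP eA; rewrite (big_rem e) //=.
have [->|/(mem_delta_entry genA (subvsP _)) //] := eqVneq (edge_value a e) 0.
by rewrite mul0r mulr0.
Qed.

End GenericEvaluation.

Theorem theorem3 (F : fieldType) (n : nat) (charF0 : [pchar F] =i pred0)
    (A : {aspace 'M[F]_n.+1})
    (grA : graded_subspace A) (genA : generated_by_elementary A)
    (f : free_galg F n) :
  graded_identity A f <->
  T_ideal_gen (fun g => I_n g \/ monomial_identity A g) f.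
Proof.
set S := fun g => _; split; last first.
  apply; first exact: graded_identity_T_ideal.
  by move=> g [/(I_n_graded_identity genA)|[]].
have [J_ideal _] := T_ideal_gen_T_ideal S.
have [id_ideal _] := graded_identity_T_ideal genA.
have [k] := ubnP #|` msupp f|; elim: k f => // k IH f fk idf.
have [f0|[w0 w0f]] := fset_0Vmem (msupp f).
  move/eqP: f0; rewrite msupp_eq0 => /eqP ->; by case: J_ideal.
(* The part of f that is split off: the words w with C w. *)
suff [C Cw0 [Jh idh]] : exists2 C : pred {fmonom gvar n}, C w0 &
    T_ideal_gen S (\sum_(w <- msupp f | C w) f@_w *: word w)
    /\ graded_identity A (\sum_(w <- msupp f | C w) f@_w *: word w).
  set h := \sum_(w <- _ | _) _ in Jh idh.
  have hE w : h@_w = if C w then f@_w else 0.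
    rewrite /h raddf_sum /=.
    under eq_bigr => v _ do rewrite mcoeffZ mcoeff_word -fmP.
    have [wf|wf] := boolP (w \in msupp f); last first.
      rewrite (mcoeff_outdom wf) if_same big_seq_cond big1 // => v /andP[vf _].
      by case: eqP vf wf => [-> ->|]; rewrite ?mulr0.
    rewrite big_mkcond (bigD1_seq w) //= eqxx mulr1.
    rewrite big1 ?addr0 // => v /negbTE ->.
    by rewrite mulr0 if_same.
  rewrite -(subrK h f).
  have [_ PD _ _] := J_ideal; apply: PD => //; apply: IH.
    rewrite ltnS in fk; apply: leq_trans fk; apply: fproper_ltn_card.
    rewrite fproperE; apply/andP; split.
      apply/fsubsetP => w; rewrite -!mcoeff_neq0 mcoeffB hE.
      by case: ifP => _; rewrite ?subr0 // subrr eqxx.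
    apply/fsubsetPn; exists w0 => //.
    by rewrite -mcoeff_eq0 mcoeffB hE Cw0 subrr.
  by case: (id_ideal) => _ idD _ _; apply: idD => //; apply: (idealN id_ideal).
have [/existsP[i iw0]|/existsPn noW] := boolP [exists i, walk_in A i w0].
  exists (fun w => perm_eq (edges i w0) (edges i w)); first exact: perm_refl.
  have -> :
      \sum_(w <- msupp f | perm_eq (edges i w0) (edges i w)) f@_w *: word w
    = \sum_(w <- msupp f | perm_eq (edges i w0) (edges i w))
        f@_w *: (word w - word w0).
    by rewrite sum_scaleB_const // (sum_coeff_same_edges genA charF0 idf iw0).
  have w_w0 w : perm_eq (edges i w0) (edges i w) -> I_n (word w - word w0).
    by rewrite perm_sym; apply: congr_I_n_perm_edges.
  split.
    apply: (ideal_sum J_ideal) => w /w_w0 Iw; apply: (idealZ J_ideal).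
    by move=> P _; apply; left.
  apply: (ideal_sum id_ideal) => w /w_w0 Iw; apply: (idealZ id_ideal).
  exact: I_n_graded_identity.
have id0 := graded_identity_no_walk genA noW.
exists (pred1 w0); first exact: eqxx.
split; last first.
  by apply: (ideal_sum id_ideal) => w /eqP ->; apply: (idealZ id_ideal).
apply: (ideal_sum J_ideal) => w /eqP ->; apply: (idealZ J_ideal).
move=> P _; apply; right; split=> //.
by exists w0; rewrite wordE fmK.
Qed.
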